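(* Let $A=(a_{ij})$ be a $d\times m$ matrix of nonnegative integers all of whose column sums are equal. Let $P=(p_1,\dots,p_m)\in\mathbf{R}_{\ge 0}^m$ be a probability distribution, i.e. $p_1+\cdots+p_m=1$. Then $P$ factors according to $A$ if and only if $P$ lies in the nonnegative toric variety $X_A$ and the support of $P$ is $A$-feasible.
   Context: Let $a_j=(a_{1j},\dots,a_{dj})$ denote the $j$-th column of $A$. The convention $t^0=1$ is used for all $t\ge 0$ (in particular $0^0=1$). The monomial map of $A$ is $\phi_A:\mathbf{R}_{\ge 0}^d\to\mathbf{R}_{\ge 0}^m$, $(t_1,\dots,t_d)\mapsto\left(\prod_{i=1}^d t_i^{a_{i1}},\dots,\prod_{i=1}^d t_i^{a_{im}}\right)$. A probability distribution $P$ factors according to $A$ if $P\in\mathrm{image}(\phi_A)$. The support of a vector $v$ is $\mathrm{supp}(v)=\{i: v_i\ne 0\}$. A subset $F\subseteq\{1,\dots,m\}$ is $A$-feasible if for every $j\in\{1,\dots,m\}\setminus F$ the set $\mathrm{supp}(a_j)$ is not contained in $\bigcup_{l\in F}\mathrm{supp}(a_l)$. The nonnegative toric variety $X_A$ is the set of all $(x_1,\dots,x_m)\in\mathbf{R}_{\ge 0}^m$ such that $x_1^{u_1}\cdots x_m^{u_m}=x_1^{v_1}\cdots x_m^{v_m}$ whenever $u,v$ are vectors of nonnegative integers satisfying $u_1a_1+\cdots+u_ma_m=v_1a_1+\cdots+v_ma_m$. *)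

(* Defs.v *)
From HB Require Import structures.
From mathcomp Require Import all_boot all_order all_algebra.
From mathcomp Require Import all_classical all_reals.

Set Implicit Arguments.
Unset Strict Implicit.
Unset Printing Implicit Defensive.

Import Order.TTheory GRing.Theory Num.Theory.
Local Open Scope ring_scope.

Definition supp (T : nmodType) (n : nat) (v : 'I_n -> T) : {set 'I_n} :=
  [set i | v i != 0]%SET.

Definition nonneg_orthant (R : realType) (n : nat) : set 'rV[R]_n :=
  [set x : 'rV[R]_n | forall i, 0 <= x 0 i]%classic.

(* In MathComp [x ^+ 0 = 1] for every [x], including [x = 0]. *)
Definition monomial_map (R : realType) (d m : nat) (A : 'M[nat]_(d, m))
    (t : 'rV[R]_d) : 'rV[R]_m :=
  \row_j \prod_i t 0 i ^+ A i j.

Definition factors (R : realType) (d m : nat) (A : 'M[nat]_(d, m)) :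
    set 'rV[R]_m :=
  (monomial_map A @` @nonneg_orthant R d)%classic.

Definition feasible (d m : nat) (A : 'M[nat]_(d, m)) (F : {set 'I_m}) : Prop :=
  forall j : 'I_m, j \notin F ->
    ~~ (supp (A^~ j) \subset (\bigcup_(l in F) supp (A^~ l))%SET).

Definition nonneg_toric_variety (R : realType) (d m : nat)
    (A : 'M[nat]_(d, m)) : set 'rV[R]_m :=
  [set x : 'rV[R]_m | nonneg_orthant x /\
    forall u v : 'I_m -> nat,
      \sum_j col j A *+ u j = \sum_j col j A *+ v j ->
      \prod_j x 0 j ^+ u j = \prod_j x 0 j ^+ v j]%classic.

(* Main.v *)
(** Where [P] vanishes, feasibility provides a row index whose parameter can be
    put to [0] without affecting the support of [P].  On the support, taking
    logarithms turns the factorization into a linear system [y A = log P] whose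
    coefficients are integers; its obstructions are spanned by integer vectors
    [w] with [A w = 0], and these vanish by the binomial equation of the toric
    variety whose exponents are the positive and negative parts of [w]. *)
Require Import Defs.
From mathcomp Require Import all_boot all_order all_algebra.
From mathcomp Require Import all_classical all_reals.
From mathcomp Require Import sequences exp.

Import Order.TTheory GRing.Theory Num.Theory.
Local Open Scope ring_scope.

Lemma rat_cV_clear_denominators (n : nat) (w : 'cV[rat]_n) :
  exists2 c : int, c != 0 & exists z : 'cV[int]_n, map_mx intr z = c%:~R *: w.
Proof.
exists (\prod_k denq (w k 0)).
  by apply/prodf_neq0 => k _; exact: denq_neq0.
exists (\col_j (numq (w j 0) * \prod_(k | k != j) denq (w k 0))).
apply/colP => j; rewrite !mxE [in RHS](bigD1 j) //= !intrM mulrAC.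
by rewrite [_ * w j 0]mulrC -numqE.
Qed.

(* Gaussian elimination commutes with the embedding of [rat] into [R], so the
   cokernel of an integer matrix over [R] has a rational basis. *)
Lemma int_linear_system_solvable (R : numFieldType) (d m : nat)
    (M : 'M[int]_(d, m)) (L : 'rV[R]_m) :
    (forall w : 'cV[int]_m, M *m w = 0 -> L *m map_mx intr w = 0) ->
  exists y : 'rV[R]_d, L = y *m map_mx intr M.
Proof.
move=> obstr; pose MQ : 'M[rat]_(d, m) := map_mx intr M.
have MQE : map_mx ratr MQ = map_mx intr M :> 'M[R]_(d, m).
  by apply/matrixP => i j; rewrite !mxE ratr_int.
(* [L] lies in the row space iff it kills the cokernel matrix; each column of that matrix is
   rational, so a nonzero integer multiple of it can be fed to [obstr]. *)
apply/submxP; rewrite -MQE submxE -map_cokermx; apply/eqP/rowP => k.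
rewrite [RHS]mxE.
have [c c0 [z zE]] := rat_cV_clear_denominators _ (col k (cokermx MQ)).
have Mz0 : M *m z = 0.
  have : map_mx intr (M *m z) = 0 :> 'cV[rat]_d.
    by rewrite map_mxM zE -scalemxAr colE mulmxA mulmx_coker mul0mx scaler0.
  move=> /colP Mz; apply/colP => i; have := Mz i; rewrite !mxE => /eqP.
  by rewrite intr_eq0 => /eqP.
have zRE : map_mx intr z =
    c%:~R *: col k (map_mx ratr (cokermx MQ)) :> 'cV[R]_m.
  apply/colP => j; have /colP/(_ j) := zE; rewrite !mxE => zj.
  by rewrite -(ratr_int R (z j 0)) zj rmorphM /= ratr_int.
have := obstr z Mz0; rewrite zRE -scalemxAr colE mulmxA -colE => /colP/(_ 0).
by rewrite !mxE => /eqP; rewrite mulf_eq0 intr_eq0 (negPf c0) => /eqP.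
Qed.

(** Substituting the parametrization turns a monomial with exponents [w] into a monomial in [t]
    whose exponent vector is the sum of the [w j] times the columns of [A]. *)
Lemma factors_toric_variety (R : realType) (d m : nat) (A : 'M[nat]_(d, m))
    (P : 'rV[R]_m) :
  factors A P -> nonneg_toric_variety A P.
Proof.
case=> t t0 <-; split=> [j|u v uv].
  by rewrite mxE; apply: prodr_ge0 => i _; exact: exprn_ge0.
have prodE (w : 'I_m -> nat) : \prod_j monomial_map A t 0 j ^+ w j =
    \prod_i t 0 i ^+ ((\sum_j col j A *+ w j)%R i 0).
  under eq_bigr do rewrite mxE -prodrXl.
  rewrite exchange_big; apply: eq_bigr => i _.
  under eq_bigr do rewrite -exprM.
  rewrite prodrXr summxE; congr (_ ^+ _); apply: eq_bigr => j _.
  by rewrite mulmxnE mxE -mulr_natr natn.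
by rewrite !prodE uv.
Qed.

(** If coordinate [j] vanishes, then some [t 0 i = 0] with [A i j] nonzero; this [i] lies in no
    column support indexed by the support of [P], since that coordinate would vanish too. *)
Lemma factors_feasible (R : realType) (d m : nat) (A : 'M[nat]_(d, m))
    (P : 'rV[R]_m) :
  factors A P -> feasible A (supp (P 0)).
Proof.
case=> t _ <- j; rewrite inE negbK mxE => /prodf_eq0[i _].
rewrite expf_eq0 => /andP[Aij ti]; apply/negP => /fintype.subsetP/(_ i).
rewrite inE -lt0n => /(_ Aij)/bigcupP[l]; rewrite !inE mxE => /prodf_neq0.
by move=> /(_ i isT); rewrite expf_eq0 (eqP ti) eqxx andbT lt0n => /negP.
Qed.

Lemma toric_variety_log_solvable (R : realType) (d m : nat)
    (A : 'M[nat]_(d, m)) (P : 'rV[R]_m) :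
    nonneg_toric_variety A P ->
  exists y : 'I_d -> R,
    forall j, j \in supp (P 0) -> ln (P 0 j) = \sum_i y i * (A i j)%:R.
Proof.
move=> [P0 toric]; pose F := supp (P 0).
(* Zero columns and entries off [F] keep the size [m] and make those equations read [0 = 0]. *)
pose M : 'M[int]_(d, m) := \matrix_(i, j) if j \in F then (A i j)%:Z else 0.
pose L : 'rV[R]_m := \row_j if j \in F then ln (P 0 j) else 0.
have [w Mw|y LE] := @int_linear_system_solvable R d m M L; last first.
  exists (y 0) => j jF; have /rowP/(_ j) := LE; rewrite !mxE jF => ->.
  by apply: eq_bigr => i _; rewrite !mxE jF.
(* Positive and negative parts of [w], cut off to [F] because [M *m w = 0] says nothing about the
   other entries. *)
pose u j := if (j \in F) && (0 <= w j 0) then absz (w j 0) else 0%N.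
pose v j := if (j \in F) && (w j 0 < 0) then absz (w j 0) else 0%N.
have uvE j : (u j)%:Z - (v j)%:Z = if j \in F then w j 0 else 0.
  rewrite /u /v; case: (j \in F) => //=.
  case: (ltP (w j 0) 0) => w0; first by rewrite sub0r ltz0_abs ?opprK.
  by rewrite gez0_abs // subr0.
have uv : \sum_j col j A *+ u j = \sum_j col j A *+ v j.
  have sumE (s : 'I_m -> nat) (i : 'I_d) :
      ((\sum_j col j A *+ s j)%R i 0)%:R = \sum_j (A i j)%:Z * (s j)%:Z.
    rewrite summxE natr_sum; apply: eq_bigr => j _.
    by rewrite mulmxnE mxE -(mulr_natr (A i j)) natn [LHS]natrM !natz.
  apply/colP => i; apply/eqP; rewrite -(eqr_nat int) !sumE -subr_eq0 -sumrB.
  have /colP/(_ i) := Mw; rewrite !mxE => Mwi; apply/eqP; rewrite -[RHS]Mwi.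
  apply: eq_bigr => j _.
  by rewrite -mulrBr uvE !mxE; case: ifP => _; rewrite ?mulr0 ?mul0r.
(* Off [F] the exponent is zero, so the factor is [0 ^+ 0 = 1], matching the exponential of [0]. *)
have prodE (s : 'I_m -> nat) : (forall j, j \notin F -> s j = 0%N) ->
    \prod_j P 0 j ^+ s j = expR (\sum_j L 0 j * (s j)%:R).
  move=> s0; rewrite expR_sum; apply: eq_bigr => j _; rewrite mxE expRM_natr.
  case: ifPn => [jF|/s0 -> //]; rewrite lnK // posrE lt0r P0 andbT.
  by move: jF; rewrite inE.
have := toric u v uv; rewrite !prodE => [|j|j]; rewrite /u /v; last first.
- by move=> /negPf ->.
- by move=> /negPf ->.
move=> /expR_inj/eqP; rewrite -subr_eq0 -sumrB => /eqP Luv.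
apply/rowP => k; rewrite ord1 !mxE -[RHS]Luv; apply: eq_bigr => j _.
rewrite -mulrBr !pmulrn -intrB uvE !mxE.
by case: ifP => // _; rewrite !mul0r.
Qed.

Lemma toric_variety_feasible_factors (R : realType) (d m : nat)
    (A : 'M[nat]_(d, m)) (P : 'rV[R]_m) :
  nonneg_toric_variety A P -> feasible A (supp (P 0)) -> factors A P.
Proof.
move=> toricP feas; have [y yE] := toric_variety_log_solvable _ _ _ _ _ toricP.
have [P0 _] := toricP; pose F := supp (P 0).
pose U := (\bigcup_(l in F) supp (A^~ l))%SET.
exists (\row_i if i \in U then expR (y i) else 0) => [i|].
  by rewrite mxE; case: ifP => // _; exact: expR_ge0.
apply/rowP => j; rewrite mxE; have [jF|jF] := boolP (j \in F); last first.
  (* The parameter at this [i] is [0] and has a positive exponent in coordinate [j]. *)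
  have /subsetPn[i iA iU] := feas j jF.
  rewrite (bigD1 i) //= mxE (negPf iU) expr0n.
  move: iA jF; rewrite !inE negbK => /negPf -> /eqP ->.
  by rewrite mul0r.
have Pj : 0 < P 0 j by rewrite lt0r P0 andbT; move: jF; rewrite inE.
rewrite -[RHS]lnK ?posrE // yE // expR_sum; apply: eq_bigr => i _.
(* For [j] in [F], a parameter set to [0] enters only with exponent zero. *)
rewrite mxE expRM_natr; have [->//|Aij] := eqVneq (A i j) 0%N.
by rewrite ifT //; apply/bigcupP; exists j; rewrite // inE.
Qed.

Theorem theorem3p1 (R : realType) (d m : nat) (A : 'M[nat]_(d, m))
    (hA : forall j k : 'I_m, (\sum_i A i j = \sum_i A i k)%N)
    (P : 'rV[R]_m) (hP0 : nonneg_orthant P) (hP1 : \sum_j P 0 j = 1) :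
  factors A P <-> nonneg_toric_variety A P /\ feasible A (supp (P 0)).
Proof.
split=> [fP|[toricP feasP]].
  by split; [exact: factors_toric_variety | exact: factors_feasible].
exact: toric_variety_feasible_factors.
Qed.
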